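(* The category ${\sf HeytFrm}$ is equivalent to the category ${\sf HA}$ and dually equivalent to the category ${\sf ES}$.
   Context: ${\sf HA}$: Heyting algebras and Heyting algebra homomorphisms. ${\sf HeytFrm}$: objects are Heyting frames, i.e. frames $L$ whose set $K(L)$ of compact elements is a Heyting subalgebra of $L$ (contains $0,1$, closed under finite meets, finite joins and the frame implication); morphisms are frame homomorphisms $\alpha:L\to M$ that send compact elements to compact elements and whose restriction $K(L)\to K(M)$ is a Heyting algebra homomorphism. ${\sf ES}$: objects are Esakia spaces (compact spaces with a partial order such that $x\not\le y$ implies there is a clopen upset containing $x$ but not $y$, and in which ${\downarrow}U$ is clopen for every clopen $U$); morphisms are Esakia morphisms, i.e. continuous maps $f$ with ${\downarrow} f^{-1}(y)=f^{-1}({\downarrow} y)$ for every $y$.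
   Formalization: Heyting frames are additionally required to be coherent (compact elements closed under finite meets and every element a join of compact ones); without this the claim fails, as the frame of opens of [0,1] shows. *)

(* Defs.v *)
From HB Require Import structures.
From mathcomp Require Import all_boot all_order.
From mathcomp Require Import all_classical.
From mathcomp Require Import topology.

Set Implicit Arguments.
Unset Strict Implicit.
Unset Printing Implicit Defensive.

Import Order.Theory.

Local Open Scope classical_set_scope.
Local Open Scope order_scope.

(** * Categories *)

Record category := Category {
  obj :> Type;
  hom : obj -> obj -> Type;
  idm : forall a, hom a a;
  comp : forall a b c, hom b c -> hom a b -> hom a c;
  comp_idl : forall a b (f : hom a b), comp (idm b) f = f;
  comp_idr : forall a b (f : hom a b), comp f (idm a) = f;
  compA : forall a b c d (h : hom c d) (g : hom b c) (f : hom a b),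
    comp h (comp g f) = comp (comp h g) f }.
Arguments hom {C} a b : rename.
Arguments idm {C} a : rename.
Arguments comp {C a b c} g f : rename.

Definition opposite (C : category) : category :=
  @Category C (fun a b => @hom C b a) (fun a => idm a)
    (fun a b c g f => comp f g)
    (fun a b f => comp_idr f) (fun a b f => comp_idl f)
    (fun a b c d h g f => esym (compA f g h)).

Record functor (C D : category) := Functor {
  fobj :> C -> D;
  fmap : forall a b, hom a b -> hom (fobj a) (fobj b);
  fmap_id : forall a, fmap (idm a) = idm (fobj a);
  fmap_comp : forall a b c (g : hom b c) (f : hom a b),
    fmap (comp g f) = comp (fmap g) (fmap f) }.
Arguments fmap {C D} F {a b} f : rename.

Definition functor_id (C : category) : functor C C :=
  @Functor C C id (fun _ _ f => f) (fun _ => erefl) (fun _ _ _ _ _ => erefl).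

Section FunctorComp.
Variables (C D E : category) (G : functor D E) (F : functor C D).

Fact functor_comp_id a : fmap G (fmap F (idm a)) = idm (G (F a)).
Proof. by rewrite !fmap_id. Qed.

Fact functor_comp_comp a b c (g : hom b c) (f : hom a b) :
  fmap G (fmap F (comp g f)) = comp (fmap G (fmap F g)) (fmap G (fmap F f)).
Proof. by rewrite !fmap_comp. Qed.

Definition functor_comp : functor C E :=
  @Functor C E (fun a => G (F a)) (fun _ _ f => fmap G (fmap F f))
    functor_comp_id functor_comp_comp.
End FunctorComp.

Definition isomorphism (C : category) (a b : C) (f : hom a b) : Prop :=
  exists g : hom b a, comp g f = idm a /\ comp f g = idm b.

Definition naturally_isomorphic (C D : category) (F G : functor C D) : Prop :=
  exists eta : forall a, hom (F a) (G a),
    (forall a b (f : hom a b), comp (eta b) (fmap F f) = comp (fmap G f) (eta a))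
    /\ (forall a, isomorphism (eta a)).

Definition equivalent (C D : category) : Prop :=
  exists (F : functor C D) (G : functor D C),
    naturally_isomorphic (functor_comp G F) (functor_id C) /\
    naturally_isomorphic (functor_comp F G) (functor_id D).

Definition dually_equivalent (C D : category) : Prop :=
  equivalent (opposite C) D.

(* The category of sets with structure [O], whose morphisms are the functions
   satisfying [P]. *)
Section ConcreteCategory.
Variables (O : Type) (sort : O -> Type).
Variable (P : forall A B : O, (sort A -> sort B) -> Prop).
Hypothesis P_id : forall A, P (A := A) (B := A) id.
Hypothesis P_comp : forall A B C (g : sort B -> sort C) (f : sort A -> sort B),
  P g -> P f -> P (g \o f).

Definition chom (A B : O) : Type := {f : sort A -> sort B | P f}.

Definition cid A : chom A A := exist _ id (P_id A).

Definition ccomp A B C (g : chom B C) (f : chom A B) : chom A C :=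
  exist _ (sval g \o sval f) (P_comp (svalP g) (svalP f)).

Lemma chom_eq A B (f g : chom A B) : sval f = sval g -> f = g.
Proof.
by case: f g => [f Pf] [g Pg] /= fg; subst g; congr exist; exact: Prop_irrelevance.
Qed.

Fact ccomp_idl A B (f : chom A B) : ccomp (cid B) f = f.
Proof. exact: chom_eq. Qed.

Fact ccomp_idr A B (f : chom A B) : ccomp f (cid A) = f.
Proof. exact: chom_eq. Qed.

Fact ccompA A B C D (h : chom C D) (g : chom B C) (f : chom A B) :
  ccomp h (ccomp g f) = ccomp (ccomp h g) f.
Proof. exact: chom_eq. Qed.

Definition concrete_category : category :=
  Category ccomp_idl ccomp_idr ccompA.
End ConcreteCategory.

(* Displays only affect the printing of order notations; all the objects below
   share this one. *)
Definition disp : Order.disp_t := Order.Disp tt tt.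

(** * Heyting algebras *)

HB.mixin Record TBLattice_isHeyting d T of Order.TBLattice d T := {
  himp : T -> T -> T;
  le_himp : forall x a b : T, (x <= himp a b) = (x `&` a <= b) }.

#[short(type="heytingType")]
HB.structure Definition Heyting d :=
  {T of Order.TBLattice d T & TBLattice_isHeyting d T}.

Definition heyting_morphism (A B : heytingType disp) (f : A -> B) : Prop :=
  [/\ f \bot = \bot, f \top = \top, {morph f : a b / a `&` b},
      {morph f : a b / a `|` b} & {morph f : a b / himp a b}].

Fact heyting_morphism_id (A : heytingType disp) :
  heyting_morphism (id : A -> A).
Proof. by split. Qed.

Fact heyting_morphism_comp (A B C : heytingType disp) (g : B -> C) (f : A -> B) :
  heyting_morphism g -> heyting_morphism f -> heyting_morphism (g \o f).
Proof.
move=> [g0 g1 gI gU gH] [f0 f1 fI fU fH]; split=> [||a b|a b|a b] /=.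
- by rewrite f0.
- by rewrite f1.
- by rewrite fI gI.
- by rewrite fU gU.
- by rewrite fH gH.
Qed.

Definition HA : category :=
  concrete_category heyting_morphism_id heyting_morphism_comp.

(** * Heyting frames *)

HB.mixin Record TBLattice_isFrame d T of Order.TBLattice d T := {
  fsup : set T -> T;
  fsup_supremums : forall A : set T, supremums A (fsup A);
  meet_fsup : forall (x : T) (A : set T),
    x `&` fsup A = fsup [set x `&` y | y in A] }.

#[short(type="frameType")]
HB.structure Definition Frame d :=
  {T of Order.TBLattice d T & TBLattice_isFrame d T}.

Section FrameTheory.
Variable L : frameType disp.

Definition frame_imp (a b : L) : L := fsup [set x | x `&` a <= b].

Definition compact_element (k : L) : Prop :=
  forall A : set L, k <= fsup A ->
    exists F : set L, [/\ finite_set F, F `<=` A & k <= fsup F].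

Definition coherent_frame : Prop :=
  [/\ compact_element \top,
      (forall a b, compact_element a -> compact_element b ->
         compact_element (a `&` b)) &
      forall x, x = fsup [set k | compact_element k /\ k <= x]].

Definition heyting_subalgebra (K : set L) : Prop :=
  [/\ K \bot, K \top, (forall a b, K a -> K b -> K (a `&` b)),
      (forall a b, K a -> K b -> K (a `|` b)) &
      (forall a b, K a -> K b -> K (frame_imp a b))].
End FrameTheory.

(* Heyting frames are by definition coherent: without joins of compact elements
   generating the frame, K(L) does not determine L. *)
Record heytFrame := HeytFrame {
  heytFrame_sort :> frameType disp;
  heytFrame_coherent : coherent_frame heytFrame_sort;
  heytFrame_heyting : heyting_subalgebra (@compact_element heytFrame_sort) }.

(* Finite joins, including \bot, are among the [fsup A]. *)
Definition frame_morphism (L M : frameType disp) (f : L -> M) : Prop :=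
  [/\ f \top = \top, {morph f : x y / x `&` y} &
      forall A : set L, f (fsup A) = fsup (f @` A)].

(* The restriction of [f] to K(L) is a Heyting algebra homomorphism, the
   operations of K(L) and K(M) being those of L and M. *)
Definition heyting_on_compact (L M : frameType disp) (f : L -> M) : Prop :=
  [/\ f \bot = \bot, f \top = \top &
      forall a b, compact_element a -> compact_element b ->
        [/\ f (a `&` b) = f a `&` f b, f (a `|` b) = f a `|` f b &
            f (frame_imp a b) = frame_imp (f a) (f b)]].

Definition heytFrame_morphism (L M : heytFrame) (f : L -> M) : Prop :=
  [/\ frame_morphism f,
      (forall k, compact_element k -> compact_element (f k)) &
      heyting_on_compact f].

Fact heytFrame_morphism_id (L : heytFrame) :
  heytFrame_morphism (id : L -> L).
Proof. by split=> //; split=> // A; rewrite image_id. Qed.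

Fact heytFrame_morphism_comp (L M N : heytFrame) (g : M -> N) (f : L -> M) :
  heytFrame_morphism g -> heytFrame_morphism f -> heytFrame_morphism (g \o f).
Proof.
move=> [[g1 gI gS] gK [g0 _ gH]] [[f1 fI fS] fK [f0 _ fH]]; split.
- split=> [|x y|A] /=; first by rewrite f1.
    by rewrite fI gI.
  by rewrite fS gS image_comp.
- by move=> k /fK /gK.
- split=> [||a b Ka Kb] /=; rewrite ?f0 ?f1 //.
  have [-> -> ->] := fH _ _ Ka Kb.
  by have [-> -> ->] := gH _ _ (fK _ Ka) (fK _ Kb).
Qed.

Definition HeytFrm : category :=
  concrete_category heytFrame_morphism_id heytFrame_morphism_comp.

(** * Esakia spaces *)

Section OrderedSpace.
Variable X : POrderedTopological.type disp.

Definition upset (U : set X) : Prop := forall x y, U x -> x <= y -> U y.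

Definition down (U : set X) : set X := [set x | exists2 y, U y & x <= y].

Definition priestley_separation : Prop :=
  forall x y : X, ~~ (x <= y) -> exists U, [/\ clopen U, upset U, U x & ~ U y].

Definition esakia_space : Prop :=
  [/\ compact [set: X], priestley_separation &
      forall U, clopen U -> clopen (down U)].
End OrderedSpace.

Record esakia := Esakia {
  esakia_sort :> POrderedTopological.type disp;
  esakiaP : esakia_space esakia_sort }.

Definition esakia_morphism (X Y : esakia) (f : X -> Y) : Prop :=
  continuous f /\
  forall y, down (f @^-1` [set y]) = f @^-1` down [set y].

Fact esakia_morphism_id (X : esakia) : esakia_morphism (id : X -> X).
Proof. by split=> [x|y]; [exact: cvg_id|rewrite !preimage_id]. Qed.

Fact esakia_morphism_comp (X Y Z : esakia) (g : Y -> Z) (f : X -> Y) :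
  esakia_morphism g -> esakia_morphism f -> esakia_morphism (g \o f).
Proof.
move=> [cg dg] [cf df]; split=> [x|z].
  by apply: continuous_comp; [exact: cf|exact: cg].
apply/seteqP; split=> [x [x' /= <- xx']|x /=].
- have: (f @^-1` down [set f x']) x by rewrite -df; exists x'.
  move=> [_ /= -> fxx'].
  have: down (g @^-1` [set g (f x')]) (f x) by exists (f x').
  by rewrite dg.
- move=> gz; have: down (g @^-1` [set z]) (f x) by rewrite dg.
  move=> [y gy fxy].
  have: down (f @^-1` [set y]) x by rewrite df; exists y.
  by move=> [x' fx' xx']; exists x' => //=; rewrite fx'.
Qed.

Definition ES : category :=
  concrete_category esakia_morphism_id esakia_morphism_comp.

(* Main.v *)
(* All three categories are compared through fully faithful and essentially
   surjective functors into HA: L |-> K(L) on Heyting frames, and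
   X |-> clopen upsets of X, contravariantly, on Esakia spaces. A Heyting
   morphism K(L) -> K(M) extends to L by h'(x) = sup {h(k) | k compact, k <= x};
   a Heyting morphism h between the clopen upsets of Y and X comes from the map
   sending x to the unique point of Y lying in exactly the U with x in h(U).
   Both functors hit A up to isomorphism through its prime spectrum: A is
   isomorphic to the clopen upsets of Spec A, which are the compact elements of
   the frame of open upsets of Spec A. *)
From HB Require Import structures.
From mathcomp Require Import all_boot all_order.
From mathcomp Require Import all_classical.
From mathcomp Require Import topology.
Require Import Defs.

Set Implicit Arguments.
Unset Strict Implicit.
Unset Printing Implicit Defensive.

Import Order.Theory.

Local Open Scope classical_set_scope.
Local Open Scope order_scope.

(** * Equivalences of categories *)

Definition full (C D : category) (F : functor C D) : Prop :=
  forall (a b : C) (g : hom (F a) (F b)), exists f, fmap F f = g.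

Definition faithful (C D : category) (F : functor C D) : Prop :=
  forall (a b : C) (f g : hom a b), fmap F f = fmap F g -> f = g.

Definition essentially_surjective (C D : category) (F : functor C D) : Prop :=
  forall d : D, exists c (e : hom (F c) d), isomorphism e.

(** Choosing for each object of [D] a preimage and an isomorphism gives the inverse functor; it
    lifts along [F] the conjugates of morphisms by these isomorphisms. *)
Lemma equivalent_of_fully_faithful (C D : category) (F : functor C D) :
  full F -> faithful F -> essentially_surjective F -> equivalent C D.
Proof.
move=> fullF faithF esF.
pose fullc a b g := boolp.cid (fullF a b g).
pose lift a b (g : hom (F a) (F b)) := projT1 (fullc a b g).
have liftK a b (g : hom (F a) (F b)) : fmap F (lift a b g) = g.
  exact: projT2 (fullc a b g).
(* Object, isomorphism and inverse are packed in one type, so that a single choice per [d] keeps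
   them compatible. *)
pose W d := {c : C & {e : hom (F c) d & {e' : hom d (F c) |
  comp e' e = idm _ /\ comp e e' = idm _}}}.
have w d : W d.
  have [c /boolp.cid[e /boolp.cid[e' ee']]] := boolp.cid (esF d).
  by exists c, e, e'.
pose G0 d : C := projT1 (w d).
pose e d : hom (F (G0 d)) d := projT1 (projT2 (w d)).
pose e' d : hom d (F (G0 d)) := sval (projT2 (projT2 (w d))).
have e'e d : comp (e' d) (e d) = idm _ by case: (svalP (projT2 (projT2 (w d)))).
have ee' d : comp (e d) (e' d) = idm _ by case: (svalP (projT2 (projT2 (w d)))).
pose G1 d1 d2 (h : hom d1 d2) : hom (G0 d1) (G0 d2) :=
  lift _ _ (comp (e' d2) (comp h (e d1))).
have G_id d : G1 _ _ (idm d) = idm (G0 d).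
  by apply: faithF; rewrite liftK comp_idl e'e fmap_id.
have G_comp d1 d2 d3 (g : hom d2 d3) (f : hom d1 d2) :
    G1 _ _ (comp g f) = comp (G1 _ _ g) (G1 _ _ f).
  apply: faithF; rewrite fmap_comp !liftK.
  by rewrite -!compA [in RHS](compA _ (e' d2)) [comp (e _) (e' _)]ee' comp_idl.
exists F, (Functor G_id G_comp); split.
- exists (fun a => lift _ _ (e (F a))); split=> [a b f|a].
    apply: faithF; rewrite !fmap_comp /= !liftK.
    by rewrite !compA ee' comp_idl.
  exists (lift _ _ (e' (F a))); split; apply: faithF.
  - by rewrite fmap_comp !liftK e'e fmap_id.
  - by rewrite fmap_comp !liftK ee' fmap_id.
- exists e; split=> [a b f|a] /=.
    by rewrite liftK !compA ee' comp_idl.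
  by exists (e' a).
Qed.

Lemma equivalent_sym (C D : category) : equivalent C D -> equivalent D C.
Proof. by move=> [F [G [GF FG]]]; exists G, F. Qed.

Lemma isomorphism_fmap (C D : category) (F : functor C D) (a b : C)
    (f : hom a b) : isomorphism f -> isomorphism (fmap F f).
Proof.
by move=> [g [gf fg]]; exists (fmap F g); rewrite -!fmap_comp gf fg !fmap_id.
Qed.

Lemma isomorphism_comp (C : category) (a b c : C) (g : hom b c) (f : hom a b) :
  isomorphism g -> isomorphism f -> isomorphism (comp g f).
Proof.
move=> [g' [g'g gg']] [f' [f'f ff']]; exists (comp f' g'); split.
  by rewrite -compA (compA g') g'g comp_idl f'f.
by rewrite -compA (compA f) ff' comp_idl gg'.
Qed.

(** Whiskering removes the inner [H]. This is the step needed twice for transitivity, where [H] is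
    the round trip through the other category. *)
Lemma naturally_isomorphic_whisker (C D E : category) (F : functor C D)
    (H : functor D D) (G : functor D E) (K : functor C E) :
  naturally_isomorphic H (functor_id D) ->
  naturally_isomorphic (functor_comp G F) K ->
  naturally_isomorphic (functor_comp G (functor_comp H F)) K.
Proof.
move=> [u [natu isou]] [v [natv isov]].
exists (fun a => comp (v a) (fmap G (u (F a)))); split=> [a b f|a].
  rewrite /= -compA -(fmap_comp G).
  have /= -> := natu _ _ (fmap F f).
  rewrite fmap_comp compA.
  by have /= -> := natv a b f; rewrite -compA.
exact: isomorphism_comp (isov a) (isomorphism_fmap (G) (isou _)).
Qed.

Lemma equivalent_trans (C D E : category) :
  equivalent C D -> equivalent D E -> equivalent C E.
Proof.
move=> [F [G [GF FG]]] [F' [G' [GF' FG']]].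
exists (functor_comp F' F), (functor_comp G G'); split.
(* The four functors reassociate by conversion, because a natural isomorphism mentions only object
   and arrow maps. *)
- exact: naturally_isomorphic_whisker GF' GF.
- exact: naturally_isomorphic_whisker FG FG'.
Qed.

Definition opposite_functor (C D : category) (F : functor C D) :
    functor (opposite C) (opposite D) :=
  @Functor (opposite C) (opposite D) F (fun a b f => @fmap C D F b a f)
    (fun a => fmap_id F a) (fun a b c g f => fmap_comp F f g).

(** The three conditions are self-dual; for essential surjectivity the inverse isomorphism takes
    over. *)
Lemma opposite_equivalent_of_fully_faithful (C D : category)
    (F : functor C D) :
  full F -> faithful F -> essentially_surjective F ->
  equivalent (opposite C) (opposite D).
Proof.
move=> fullF faithF esF.
apply: (@equivalent_of_fully_faithful _ _ (opposite_functor F)).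
- by move=> a b g; exact: fullF.
- by move=> a b f g; exact: faithF.
- move=> d; have [c [e [e' [e'e ee']]]] := esF d.
  by exists c, e', e.
Qed.

(** * Sublattices *)

Record tb_closed d (T : tbLatticeType d) (P : set T) : Prop := TBClosed {
  closed_bot : P \bot;
  closed_top : P \top;
  closed_meet : forall a b, P a -> P b -> P (a `&` b);
  closed_join : forall a b, P a -> P b -> P (a `|` b) }.

(** The closure proof is an argument of the type, so that the lattice instances can read it off the
    type. *)
Definition sublattice d (T : tbLatticeType d) (P : set T)
  of tb_closed P := {x : T | P x}.

Section Sublattice.
Variables (d : Order.disp_t) (T : tbLatticeType d) (P : set T).
Variable cP : tb_closed P.
Local Notation S := (sublattice cP).
Implicit Types x y z : S.

HB.instance Definition _ := gen_eqMixin S.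
HB.instance Definition _ := gen_choiceMixin S.

Lemma sublattice_inj x y : sval x = sval y -> x = y.
Proof.
by case: x y => [x Px] [y Py] /= xy; subst y; congr exist; exact: Prop_irrelevance.
Qed.

Let le x y := sval x <= sval y.
Let le_refl : reflexive le. Proof. by move=> x; exact: lexx. Qed.
Let le_anti : antisymmetric le.
Proof. by move=> x y /le_anti /sublattice_inj. Qed.
Let le_trans : transitive le.
Proof. by move=> y x z; exact: le_trans. Qed.

HB.instance Definition _ :=
  Order.Le_isPOrder.Build disp S le_refl le_anti le_trans.

Let meet x y : S := exist _ _ (closed_meet cP (svalP x) (svalP y)).
Let join x y : S := exist _ _ (closed_join cP (svalP x) (svalP y)).
Let meetP x y z : (x <= meet y z) = (x <= y) && (x <= z).
Proof. exact: lexI. Qed.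
Let joinP x y z : (join x y <= z) = (x <= z) && (y <= z).
Proof. exact: leUx. Qed.

HB.instance Definition _ :=
  Order.POrder_MeetJoin_isLattice.Build disp S meetP joinP.

Let bot : S := exist _ _ (closed_bot cP).
Let top : S := exist _ _ (closed_top cP).
Let botP x : bot <= x. Proof. exact: le0x. Qed.
Let topP x : x <= top. Proof. exact: lex1. Qed.

HB.instance Definition _ := Order.hasBottom.Build disp S botP.
HB.instance Definition _ := Order.hasTop.Build disp S topP.
End Sublattice.

(** * Compact elements of Heyting frames *)

Section FrameLemmas.
Variable L : frameType disp.
Implicit Types (a b x y : L) (A : set L).

Lemma fsup_ge A x : A x -> x <= fsup A.
Proof. by have [ubA _] := fsup_supremums A; exact: ubA. Qed.

Lemma fsup_le A b : (forall x, A x -> x <= b) -> fsup A <= b.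
Proof. by move=> Ab; have [_ lbA] := fsup_supremums A; apply: lbA. Qed.

Lemma meet_fsup_le a A b :
  (forall x, A x -> a `&` x <= b) -> a `&` fsup A <= b.
Proof. by move=> Ab; rewrite meet_fsup; apply: fsup_le => _ [x Ax <-]; exact: Ab. Qed.

(** Distributivity of meets over [fsup] puts the supremum itself among the elements whose meet with
    [a] is below [b]. *)
Lemma le_frame_imp x a b : (x <= frame_imp a b) = (x `&` a <= b).
Proof.
apply/idP/idP => [xab|]; last by move=> xab; exact: fsup_ge.
rewrite meetC; apply: le_trans (leI2 (lexx a) xab) _.
by apply: meet_fsup_le => y; rewrite /= meetC.
Qed.

(** Finite suprema are iterated binary joins, by induction on an enumeration of [A]. *)
Lemma finite_fsup_closed A (P : set L) :
  finite_set A -> P \bot -> (forall a b, P a -> P b -> P (a `|` b)) ->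
  A `<=` P -> P (fsup A).
Proof.
move=> /finite_seqP[s ->] P0 PU; elim: s => [|a s IHs] sP.
  suff -> : fsup [set` [::]] = \bot :> L by [].
  by apply/eqP; rewrite -lex0; apply: fsup_le => x; rewrite /= in_nil.
have -> : fsup [set` a :: s] = a `|` fsup [set` s].
  apply/le_anti/andP; split.
    apply: fsup_le => x /=; rewrite inE => /predU1P[->|xs]; first exact: leUl.
    by apply: le_trans (leUr _ _); exact: fsup_ge.
  rewrite leUx; apply/andP; split; first by apply: fsup_ge; rewrite /= mem_head.
  by apply: fsup_le => x /= xs; apply: fsup_ge; rewrite /= inE xs orbT.
apply: PU; first by apply: sP; rewrite /= mem_head.
by apply: IHs => x xs; apply: sP; rewrite /= inE xs orbT.
Qed.
End FrameLemmas.

Lemma compact_tb_closed (L : heytFrame) : tb_closed (@compact_element L).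
Proof. by have [] := heytFrame_heyting L. Qed.

Definition compacts (L : heytFrame) := sublattice (compact_tb_closed L).

Section Compacts.
Variable L : heytFrame.

HB.instance Definition _ := Order.TBLattice.on (compacts L).

Lemma compact_frame_imp (a b : L) :
  compact_element a -> compact_element b -> compact_element (frame_imp a b).
Proof. by have [_ _ _ _] := heytFrame_heyting L; apply. Qed.

Let himp (a b : compacts L) : compacts L :=
  exist _ _ (compact_frame_imp (svalP a) (svalP b)).

Let le_himp (x a b : compacts L) : (x <= himp a b) = (x `&` a <= b).
Proof. exact: le_frame_imp. Qed.

HB.instance Definition _ := TBLattice_isHeyting.Build disp (compacts L) le_himp.

Lemma compacts_leE (a b : compacts L) : (a <= b) = (sval a <= sval b).
Proof. by []. Qed.

Lemma compacts_botE : sval (\bot : compacts L) = \bot.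
Proof. by []. Qed.

Lemma compacts_meetE (a b : compacts L) : sval (a `&` b) = sval a `&` sval b.
Proof. by []. Qed.

Lemma compacts_joinE (a b : compacts L) : sval (a `|` b) = sval a `|` sval b.
Proof. by []. Qed.

Lemma compacts_himpE (a b : compacts L) :
  sval (Defs.himp a b) = frame_imp (sval a) (sval b).
Proof. by []. Qed.
End Compacts.

Definition compacts_map (L M : heytFrame) (f : L -> M)
    (fK : forall k, compact_element k -> compact_element (f k))
    (k : compacts L) : compacts M :=
  exist _ (f (sval k)) (fK _ (svalP k)).

Lemma compacts_map_morphism (L M : heytFrame) (f : L -> M)
    (fP : heytFrame_morphism f) :
  heyting_morphism (compacts_map (let: And3 _ fK _ := fP in fK)).
Proof.
case: fP => [fF fK [f0 f1 fH]]; split=> [||[a Ka] [b Kb]|[a Ka] [b Kb]|[a Ka] [b Kb]];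
  apply: sublattice_inj => //=; by have [] := fH _ _ Ka Kb.
Qed.

Definition K_map (L M : HeytFrm) (f : hom L M) :
    @hom HA (compacts L) (compacts M) :=
  exist _ _ (compacts_map_morphism (svalP f)).

Lemma K_map_id (L : HeytFrm) : K_map (idm L) = idm (compacts L : HA).
Proof. by apply: chom_eq; apply/funext => k; exact: sublattice_inj. Qed.

Lemma K_map_comp (L M N : HeytFrm) (g : hom M N) (f : hom L M) :
  K_map (comp g f) = comp (K_map g) (K_map f).
Proof. by apply: chom_eq; apply/funext => k; exact: sublattice_inj. Qed.

Definition K : functor HeytFrm HA :=
  @Functor HeytFrm HA (fun L => compacts L) K_map K_map_id K_map_comp.

Lemma coherentE (L : heytFrame) (x : L) :
  x = fsup [set k | compact_element k /\ k <= x].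
Proof. by have [] := heytFrame_coherent L. Qed.

(** By coherence every element is a supremum of compact ones, so a map preserving suprema is
    determined by its values on these. *)
Lemma K_faithful : faithful K.
Proof.
move=> L M f g /(congr1 sval) fg; apply: chom_eq; apply/funext => x.
have [[_ _ fS] _ _] := svalP f; have [[_ _ gS] _ _] := svalP g.
have fgK k : compact_element k -> sval f k = sval g k.
  by move=> Kk; have /(congr1 sval) := congr1 (@^~ (exist _ k Kk)) fg.
rewrite [x]coherentE fS gS; congr fsup; apply/seteqP; split=> y [k [Kk kx] <-];
  by exists k => //; rewrite fgK.
Qed.

Lemma heyting_morphism_le (A B : heytingType disp) (h : A -> B) (a b : A) :
  heyting_morphism h -> a <= b -> h a <= h b.
Proof. by move=> [_ _ hI _ _] /meet_idPl ab; rewrite -ab hI leIr. Qed.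

(** * Extension of Heyting morphisms from compact elements to frames *)

Section KFull.
Variables (L M : heytFrame) (h : compacts L -> compacts M).
Hypothesis hP : heyting_morphism h.

Definition extend (x : L) : M :=
  fsup [set sval (h k) | k in [set k : compacts L | sval k <= x]].

Lemma extend_compact (k : compacts L) : extend (sval k) = sval (h k).
Proof.
apply/le_anti/andP; split; last by apply: fsup_ge; exists k => /=.
by apply: fsup_le => _ [l lk <-]; exact: heyting_morphism_le hP lk.
Qed.

Lemma extend_le x y : x <= y -> extend x <= extend y.
Proof.
move=> xy; apply: fsup_le => _ [k /= kx <-].
by apply: fsup_ge; exists k => //=; exact: le_trans xy.
Qed.

(** Distributing over both suprema leaves pairs of compact elements, whose meets are again
    compact. *)
Lemma extend_meet : {morph extend : x y / x `&` y}.
Proof.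
have [_ _ hI _ _] := hP.
move=> x y; apply/le_anti/andP; split.
  by rewrite lexI !extend_le ?leIl ?leIr.
apply: meet_fsup_le => _ [k /= ky <-]; rewrite meetC.
apply: meet_fsup_le => _ [l /= lx <-].
rewrite -compacts_meetE -hI; apply: fsup_ge; exists (k `&` l) => //=.
by rewrite meetC leI2.
Qed.

Lemma extend_fsup A : extend (fsup A) = fsup (extend @` A).
Proof.
have [h0 _ _ hU _] := hP.
apply/le_anti/andP; split; last first.
  by apply: fsup_le => _ [x Ax <-]; apply: extend_le; exact: fsup_ge.
apply: fsup_le => _ [k /= kA <-].
set b := fsup (extend @` A).
(* Replacing [A] by the compact elements below its members does not lower the supremum, and [h] is
   defined on the finite subset that compactness of [k] then extracts. *)
pose D := [set l : L | compact_element l /\ exists2 x, A x & l <= x].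
have kD : sval k <= fsup D.
  apply: le_trans kA _; apply: fsup_le => x Ax; rewrite [x]coherentE.
  by apply: fsup_le => l [Kl lx]; apply: fsup_ge; split=> //; exists x.
have [F [finF FD kF]] := svalP k _ kD.
(* The compact elements sent below [b] form an ideal containing [F]. *)
have [l lF lb] : [set l : L | exists2 l' : compacts L,
    sval l' = l & sval (h l') <= b] (fsup F).
  apply: finite_fsup_closed => //.
  - by exists \bot => //; rewrite h0 compacts_botE le0x.
  - move=> _ _ [x <- xb] [y <- yb]; exists (x `|` y) => //.
    by rewrite hU compacts_joinE leUx xb.
  - move=> l /FD[Kl [x Ax lx]]; exists (exist _ l Kl) => //.
    rewrite -extend_compact; apply: le_trans (extend_le lx) _.
    by apply: fsup_ge; exists x.
apply: le_trans lb; rewrite -compacts_leE; apply: heyting_morphism_le hP _.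
by rewrite compacts_leE lF.
Qed.

Lemma extend_morphism : heytFrame_morphism extend.
Proof.
have [h0 h1 hI hU hH] := hP.
have e0 : extend \bot = \bot by rewrite (extend_compact \bot) h0.
have e1 : extend \top = \top by rewrite (extend_compact \top) h1.
split; first by split=> //; [exact: extend_meet|exact: extend_fsup].
- by move=> k Kk; rewrite (extend_compact (exist _ k Kk)); exact: svalP.
- split=> // a b Ka Kb.
  rewrite (extend_compact (exist _ a Ka)) (extend_compact (exist _ b Kb)).
  rewrite -compacts_meetE -compacts_joinE -compacts_himpE -hI -hU -hH.
  by rewrite -!extend_compact.
Qed.
End KFull.

Lemma K_full : full K.
Proof.
move=> L M h; exists (exist _ _ (extend_morphism (svalP h))).
apply: chom_eq; apply/funext => k; apply: sublattice_inj.
exact: extend_compact (svalP h) k.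
Qed.

(** * Order isomorphisms of Heyting algebras *)

Lemma isomorphism_of_order_iso (A B : HA) (f : hom A B) :
  (forall a b, (sval f a <= sval f b) = (a <= b)) ->
  (forall b, exists a, sval f a = b) -> isomorphism f.
Proof.
move=> f_mono f_surj; pose g b := projT1 (boolp.cid (f_surj b)).
have fK b : sval f (g b) = b := projT2 (boolp.cid (f_surj b)).
have f_inj a b : sval f a = sval f b -> a = b.
  by move=> fab; apply/le_anti; rewrite -!f_mono fab lexx.
have [f0 f1 fI fU fH] := svalP f.
have gP : heyting_morphism g.
  by split=> [||a b|a b|a b]; apply: f_inj; rewrite ?(fI, fU, fH) !fK.
by exists (exist _ g gP); split; apply: chom_eq; apply/funext => a /=;
  [apply: f_inj; rewrite fK|rewrite fK].
Qed.

(** All the operations have universal properties in terms of the order; each bound in [B] is pulled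
    back along [f] and compared in [A]. *)
Lemma heyting_morphism_of_order_iso (A B : heytingType disp) (f : A -> B) :
  (forall a b, (f a <= f b) = (a <= b)) ->
  (forall b, exists a, f a = b) -> heyting_morphism f.
Proof.
move=> f_mono f_surj; split=> [||a b|a b|a b]; apply/le_anti.
- by have [a fa] := f_surj \bot; rewrite le0x -{1}fa f_mono le0x.
- by have [a fa] := f_surj \top; rewrite lex1 -{1}fa f_mono lex1.
- rewrite lexI !f_mono leIl leIr /=.
  have [c fc] := f_surj (f a `&` f b).
  by rewrite -fc f_mono lexI -!f_mono fc leIl leIr.
- rewrite leUx !f_mono leUl leUr andbT.
  have [c fc] := f_surj (f a `|` f b).
  by rewrite -fc f_mono leUx -!f_mono fc leUl leUr.
- rewrite le_himp; apply/andP; split.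
    have [c fc] := f_surj (f (himp a b) `&` f a).
    rewrite -fc f_mono; apply: (@le_trans _ _ (himp a b `&` a)).
      by rewrite lexI -!f_mono fc leIl leIr.
    by rewrite -le_himp.
  have [c fc] := f_surj (himp (f a) (f b)).
  rewrite -fc f_mono le_himp -f_mono.
  apply: (@le_trans _ _ (f c `&` f a)); first by rewrite lexI !f_mono leIl leIr.
  by rewrite fc -le_himp.
Qed.

(** * Compact ordered spaces *)

Local Open Scope classical_set_scope.

(** The family is a base of a proper filter, and a cluster point of it lies in each member, these
    being closed. Compactness is used below in this form. *)
Lemma compact_directed (X : topologicalType) (D : set (set X)) :
  compact [set: X] -> D !=set0 ->
  (forall C C', D C -> D C' -> exists2 E, D E & E `<=` C `&` C') ->
  (forall C, D C -> closed C /\ C !=set0) ->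
  exists x, forall C, D C -> C x.
Proof.
move=> cX D0 D_dir DP.
have F_filter : Filter (filter_from D id) by exact: filter_from_filter.
have F_proper : ProperFilter (filter_from D id).
  by apply: filter_from_proper => C /DP[].
have [|x [_ clx]] := cX _ F_proper; first by have [C DC] := D0; exists C.
exists x => C DC; have [clC _] := DP _ DC; apply: clC => W Wx.
by apply: clx => //; exists C.
Qed.

(** * Separating lattices of clopen upsets *)

Section SeparatingLattice.
(** [B] is abstract because it has two instances: all clopen upsets of an Esakia space, and the sets
    [phi a] in a spectrum, before these are known to be all its clopen upsets. *)
Variables (X : POrderedTopological.type disp) (B : set (set X)).
Hypothesis cX : compact [set: X].
Hypothesis B_closed : tb_closed B.
Hypothesis B_clopen : forall V, B V -> clopen V /\ upset V.
Hypothesis B_sep : forall x y : X, ~~ (x <= y) -> exists V, [/\ B V, V x & ~ V y].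

Let B0 : B set0 := closed_bot B_closed.
Let BT : B setT := closed_top B_closed.
Let BI U V : B U -> B V -> B (U `&` V).
Proof. exact: (closed_meet B_closed). Qed.
Let BU U V : B U -> B V -> B (U `|` V).
Proof. exact: (closed_join B_closed). Qed.

Let B_open V : B V -> open V.
Proof. by move=> /B_clopen[[]]. Qed.
Let B_closed_set V : B V -> closed V.
Proof. by move=> /B_clopen[[]]. Qed.
Let B_closedC V : B V -> closed (~` V).
Proof. by move=> /B_open; exact: open_closedC. Qed.

Lemma sep_le (x y : X) : (forall V, B V -> V x -> V y) -> x <= y.
Proof.
move=> xy; apply: contrapT => /negP /B_sep[V [BV Vx Vy]]; exact: Vy (xy V BV Vx).
Qed.

(** Otherwise compactness gives a point [z] outside [U] lying in every member of [B] that contains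
    [x]. Then [x <= z], and [z] lies in the upset [U] after all. *)
Lemma open_upset_base (U : set X) x :
  open U -> upset U -> U x -> exists V, [/\ B V, V x & V `<=` U].
Proof.
move=> oU uU Ux; apply: contrapT => noV.
pose D := [set C | exists V, [/\ B V, V x & C = V `\` U]].
have [z Dz] : exists z, forall C, D C -> C z.
  apply: compact_directed => //.
  - by exists (setT `\` U), setT.
  - move=> _ _ [V [BV Vx ->]] [V' [BV' Vx' ->]]; exists ((V `&` V') `\` U).
      by exists (V `&` V'); split=> //; exact: BI.
    by move=> z [[? ?] ?].
  - move=> _ [V [BV Vx ->]]; split.
      by apply: closedI; [exact: B_closed_set|exact: open_closedC].
    apply/set0P/eqP => VU; apply: noV; exists V; split=> //.
    by rewrite -setD_eq0.
have [_ Uz] : (setT `\` U) z by apply: Dz; exists setT.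
apply: Uz; apply: uU Ux _; apply: sep_le => V BV Vx.
by have [] : (V `\` U) z by apply: Dz; exists V.
Qed.

(** The members of [B] inside [U] cover it and are closed under unions, so by compactness one of
    them is already [U]. *)
Lemma clopen_upset_base (U : set X) : clopen U -> upset U -> B U.
Proof.
move=> [oU cU] uU; apply: contrapT => nBU.
pose D := [set C | exists V, [/\ B V, V `<=` U & C = U `\` V]].
have [z Dz] : exists z, forall C, D C -> C z.
  apply: compact_directed => //.
  - by exists (U `\` set0), set0; split=> //; exact: sub0set.
  - move=> _ _ [V [BV VU ->]] [V' [BV' VU' ->]]; exists (U `\` (V `|` V')).
      exists (V `|` V'); split=> //; first exact: BU.
      by move=> z [/VU|/VU'].
    by move=> z [Uz nVV]; split; split=> // Vz; apply: nVV; [left|right].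
  - move=> _ [V [BV VU ->]]; split.
      by apply: closedI => //; exact: B_closedC.
    apply/set0P/eqP; rewrite setD_eq0 => UV; apply: nBU.
    by have -> : U = V by apply/seteqP.
have [Uz _] : (U `\` set0) z by apply: Dz; exists set0; split=> //; exact: sub0set.
have [V [BV Vz VU]] := open_upset_base oU uU Uz.
by have [_] : (U `\` V) z by apply: Dz; exists V.
Qed.

(** If no difference fits inside [W], compactness yields a point outside [W] that lies in the same
    members of [B] as [x], hence equals [x]. *)
Lemma open_base (W : set X) x : open W -> W x ->
  exists U V, [/\ B U, B V, U x, ~ V x & U `\` V `<=` W].
Proof.
move=> oW Wx; apply: contrapT => noUV.
pose D := [set C | exists U V, [/\ B U, B V, U x, ~ V x & C = (U `\` V) `\` W]].
have [z Dz] : exists z, forall C, D C -> C z.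
  apply: compact_directed => //.
  - by exists ((setT `\` set0) `\` W), setT, set0; split.
  - move=> _ _ [U [V [BU1 BV1 Ux Vx ->]]] [U' [V' [BU2 BV2 Ux' Vx' ->]]].
    exists (((U `&` U') `\` (V `|` V')) `\` W).
      exists (U `&` U'), (V `|` V'); split=> //.
      - exact: BI.
      - exact: BU.
      - by case.
    move=> z [[[Uz Uz'] nVV] nWz].
    by split; split=> //; split=> // Vz; apply: nVV; [left|right].
  - move=> _ [U [V [BU1 BV1 Ux Vx ->]]]; split.
      apply: closedI; last exact: open_closedC.
      by apply: closedI; [exact: B_closed_set|exact: B_closedC].
    apply/set0P/eqP; rewrite setD_eq0 => UVW; apply: noUV.
    by exists U, V.
have [_ nWz] : ((setT `\` set0) `\` W) z by apply: Dz; exists setT, set0; split.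
suff zx : z = x by apply: nWz; rewrite zx.
apply/le_anti/andP; split; apply: sep_le => V BV Vz.
- apply: contrapT => nVx.
  by have [[_]] : ((setT `\` V) `\` W) z by apply: Dz; exists setT, V; split.
- by have [[]] : ((V `\` set0) `\` W) z by apply: Dz; exists V, set0; split.
Qed.

Lemma closed_up (x : X) : closed [set y | x <= y].
Proof.
move=> y cly; apply: sep_le => V BV Vx; apply: (B_closed_set BV) => W /cly[z [/= xz Wz]].
by exists z; split=> //; have [_ uV] := B_clopen BV; exact: uV Vx xz.
Qed.

(** For [x] in the closure of [down U], each [V] in [B] around [x] meets [down U], hence [U] since
    [V] is an upset. Compactness gives a point of [U] in all these [V], thus above [x]. *)
Lemma closed_down (U : set X) : closed U -> closed (down U).
Proof.
move=> cU x clx.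
pose D := [set C | exists V, [/\ B V, V x & C = U `&` V]].
have [z Dz] : exists z, forall C, D C -> C z.
  apply: compact_directed => //.
  - by exists (U `&` setT), setT.
  - move=> _ _ [V [BV Vx ->]] [V' [BV' Vx' ->]]; exists (U `&` (V `&` V')).
      by exists (V `&` V'); split=> //; exact: BI.
    by move=> z [? [? ?]].
  - move=> _ [V [BV Vx ->]]; split.
      by apply: closedI => //; exact: B_closed_set.
    have /clx[y [[z Uz yz] Vy]] : nbhs x V.
      by apply: open_nbhs_nbhs; split=> //; exact: B_open.
    by exists z; split=> //; have [_ uV] := B_clopen BV; exact: uV Vy yz.
have [Uz _] : (U `&` setT) z by apply: Dz; exists setT.
exists z => //; apply: sep_le => V BV Vx.
by have [] : (U `&` V) z by apply: Dz; exists V.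
Qed.
End SeparatingLattice.

(** * Clopen upsets of Esakia spaces *)

Section Upsets.
Variable X : POrderedTopological.type disp.

Lemma upset0 : upset (set0 : set X). Proof. by []. Qed.

Lemma upsetT : upset (setT : set X). Proof. by []. Qed.

Lemma upsetI (U V : set X) : upset U -> upset V -> upset (U `&` V).
Proof. by move=> uU uV x y [Ux Vx] xy; split; [exact: uU xy|exact: uV xy]. Qed.

Lemma upset_bigcup I (P : set I) (F : I -> set X) :
  (forall i, P i -> upset (F i)) -> upset (\bigcup_(i in P) F i).
Proof. by move=> uF x y [i Pi Fx] xy; exists i => //; exact: uF xy. Qed.

Lemma upsetU (U V : set X) : upset U -> upset V -> upset (U `|` V).
Proof. by move=> uU uV x y [Ux|Vx] xy; [left; exact: uU xy|right; exact: uV xy]. Qed.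

(** The Heyting implication of the lattice of upsets: the points whose upper bounds in [U] all lie
    in [V]. *)
Definition upset_imp (U V : set X) : set X := ~` down (U `\` V).

Lemma upset_upset_imp U V : upset (upset_imp U V).
Proof.
move=> x y nx xy [z UVz yz]; apply: nx; exists z => //; exact: le_trans yz.
Qed.

Lemma upset_impP (W U V : set X) :
  upset W -> W `<=` upset_imp U V <-> W `&` U `<=` V.
Proof.
move=> uW; split=> [WUV x [Wx Ux]|WUV x Wx [y [Uy nVy] xy]].
  by apply: contrapT => nVx; apply: (WUV x Wx); exists x.
by apply: nVy; apply: WUV; split=> //; exact: uW xy.
Qed.

Definition clopen_upset : set (set X) := [set U | clopen U /\ upset U].

Lemma clopen_upset_tb_closed : tb_closed clopen_upset.
Proof.
split=> [||U V [cU uU] [cV uV]|U V [cU uU] [cV uV]].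
- split; [split; [exact: open0|exact: closed0]|exact: upset0].
- split; [split; [exact: openT|exact: closedT]|exact: upsetT].
- split; [exact: clopenI|exact: upsetI].
- split; [exact: clopenU|exact: upsetU].
Qed.
End Upsets.

Definition clopup (X : esakia) := sublattice (clopen_upset_tb_closed X).

Section Clopup.
Variable X : esakia.

Lemma esakia_compact : compact [set: X].
Proof. by have [] := esakiaP X. Qed.

Lemma esakia_sep (x y : X) : ~~ (x <= y) ->
  exists U, [/\ clopen_upset U, U x & ~ U y].
Proof. by have [_ sep _] := esakiaP X => /sep[U [? ? ? ?]]; exists U. Qed.

(** The Esakia condition that [down] preserves clopen sets is what keeps the implication clopen. *)
Lemma clopen_upset_imp (U V : set X) :
  clopen U -> clopen V -> clopen_upset (upset_imp U V).
Proof.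
have [_ _ cldown] := esakiaP X.
move=> cU cV; split; last exact: upset_upset_imp.
apply: (clopenC set0); apply: cldown.
by apply: clopenI => //; exact: (clopenC set0).
Qed.

HB.instance Definition _ := Order.TBLattice.on (clopup X).

Lemma clopup_leP (U V : clopup X) : reflect (sval U `<=` sval V) (U <= V).
Proof. exact: subsetPset. Qed.

Let himp (U V : clopup X) : clopup X :=
  exist _ _ (clopen_upset_imp (proj1 (svalP U)) (proj1 (svalP V))).

Let le_himp (W U V : clopup X) : (W <= himp U V) = (W `&` U <= V)%O.
Proof.
by apply/clopup_leP/clopup_leP => /(upset_impP _ _ (proj2 (svalP W))).
Qed.

HB.instance Definition _ := TBLattice_isHeyting.Build disp (clopup X) le_himp.

Lemma clopup_himpE (U V : clopup X) :
  sval (Defs.himp U V) = upset_imp (sval U) (sval V).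
Proof. by []. Qed.
End Clopup.

Lemma esakia_morphism_le (X Y : esakia) (f : X -> Y) (x y : X) :
  esakia_morphism f -> x <= y -> f x <= f y.
Proof.
move=> [_ df] xy; have : down (f @^-1` [set f y]) x by exists y.
by rewrite df => -[_ /= ->].
Qed.

(** The condition on single points extends to all sets, a downset being a union of principal ones;
    preservation of implication follows. *)
Lemma esakia_preimage_down (X Y : esakia) (f : X -> Y) (U : set Y) :
  esakia_morphism f -> f @^-1` down U = down (f @^-1` U).
Proof.
move=> fP; apply/seteqP; split=> x.
  move=> [y Uy fxy]; have : (f @^-1` down [set y]) x by exists y.
  have [_ <-] := fP; move=> [x' /= fx' xx']; exists x' => //=.
  by rewrite fx'.
by move=> [x' Ux' xx']; exists (f x') => //; exact: esakia_morphism_le fP xx'.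
Qed.

Lemma preimage_upset_imp (X Y : esakia) (f : X -> Y) (U V : set Y) :
  esakia_morphism f ->
  f @^-1` upset_imp U V = upset_imp (f @^-1` U) (f @^-1` V).
Proof. by move=> fP; rewrite /upset_imp -preimage_setC esakia_preimage_down. Qed.

Lemma preimage_clopen_upset (X Y : esakia) (f : X -> Y) (U : set Y) :
  esakia_morphism f -> clopen_upset U -> clopen_upset (f @^-1` U).
Proof.
move=> fP [cU uU]; split; first by apply: preimage_clopen => //; case: fP.
by move=> x y Ux xy; apply: uU Ux _; exact: esakia_morphism_le fP xy.
Qed.

Definition clopup_map (X Y : ES) (f : hom X Y) (U : clopup Y) : clopup X :=
  exist _ _ (preimage_clopen_upset (svalP f) (svalP U)).

Lemma clopup_map_morphism (X Y : ES) (f : hom X Y) :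
  heyting_morphism (clopup_map f).
Proof.
split=> [||U V|U V|U V]; apply: sublattice_inj => //.
exact: preimage_upset_imp (svalP f).
Qed.

Definition CU_map (X Y : ES) (f : hom X Y) :
    @hom (opposite HA) (clopup X) (clopup Y) :=
  exist _ _ (clopup_map_morphism f).

Lemma CU_map_id (X : ES) : CU_map (idm X) = @idm (opposite HA) (clopup X).
Proof. by apply: chom_eq; apply/funext => U; exact: sublattice_inj. Qed.

Lemma CU_map_comp (X Y Z : ES) (g : hom Y Z) (f : hom X Y) :
  CU_map (comp g f) = comp (CU_map g) (CU_map f).
Proof. by apply: chom_eq; apply/funext => U; exact: sublattice_inj. Qed.

Definition CU : functor ES (opposite HA) :=
  @Functor ES (opposite HA) (fun X => clopup X) CU_map CU_map_id CU_map_comp.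

(** Clopen upsets determine the order, so two points lying in the same ones coincide. *)
Lemma CU_faithful : faithful CU.
Proof.
move=> X Y f g /(congr1 sval) /= fg; apply: chom_eq; apply/funext => x.
have fgU (U : set Y) : clopen_upset U -> U (sval f x) = U (sval g x).
  move=> UP; have /(congr1 sval) /= := congr1 (@^~ (exist _ U UP)) fg.
  by move=> /(congr1 (@^~ x)).
apply/le_anti/andP; split; apply: (sep_le (@esakia_sep Y)) => U UP;
  by rewrite fgU.
Qed.

(** * Esakia morphisms dual to Heyting morphisms *)

Section CUFull.
Variables (X Y : esakia) (h : clopup Y -> clopup X).
Hypothesis hP : heyting_morphism h.

Let h_le U V : sval U `<=` sval V -> sval (h U) `<=` sval (h V).
Proof. by move=> /clopup_leP /(heyting_morphism_le hP) /clopup_leP. Qed.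

(* [fun U => sval (h U) x] is a prime filter of clopen upsets of [Y]; it is
   principal by compactness. *)
Lemma dual_point (x : X) :
  exists y : Y, forall U, sval (h U) x <-> sval U y.
Proof.
have [h0 h1 hI hU hH] := hP.
(* A point common to all these differences realizes the filter exactly: [V] empty gives one
   implication, [U] the whole space the other. *)
pose D := [set C : set Y | exists U V : clopup Y,
  [/\ sval (h U) x, ~ sval (h V) x & C = sval U `\` sval V]].
have hT : sval (h \top%O) x by rewrite h1.
have hB : ~ sval (h \bot%O) x by rewrite h0.
have [y Dy] : exists y, forall C, D C -> C y.
  apply: compact_directed; first exact: esakia_compact.
  - by exists (sval (\top%O : clopup Y) `\` sval (\bot%O : clopup Y)), \top%O, \bot%O.
  - move=> _ _ [U [V [xU xV ->]]] [U' [V' [xU' xV' ->]]].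
    exists (sval (U `&` U')%O `\` sval (V `|` V')%O).
      exists (U `&` U')%O, (V `|` V')%O; split=> //; first by rewrite hI.
      by rewrite hU => -[].
    move=> z [[Uz Uz'] nV]; split; split=> // Vz; apply: nV; [by left|by right].
  - move=> _ [U [V [xU xV ->]]]; split.
      by apply: closedI; [|apply: open_closedC]; case: (svalP U) (svalP V) => -[? ?] ? [[? ?] ?].
    by apply/set0P/eqP; rewrite setD_eq0 => /h_le UV; exact: xV (UV x xU).
exists y => U; split=> [xU|Uy].
  by have [] : (sval U `\` sval (\bot%O : clopup Y)) y by apply: Dy; exists U, \bot%O.
apply: contrapT => nxU.
by have [] : (sval (\top%O : clopup Y) `\` sval U) y by apply: Dy; exists \top%O, U.
Qed.

Definition dual_map (x : X) : Y := projT1 (boolp.cid (dual_point x)).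

Lemma dual_mapP x U : sval (h U) x <-> sval U (dual_map x).
Proof. exact: (projT2 (boolp.cid (dual_point x))). Qed.

Lemma dual_map_le x x' : x <= x' -> dual_map x <= dual_map x'.
Proof.
move=> xx'; apply: (sep_le (@esakia_sep Y)) => U UP.
move=> /(dual_mapP x (exist _ U UP)) xU; apply/(dual_mapP x' (exist _ U UP)).
by have [_ uhU] := svalP (h (exist _ U UP)); exact: uhU xU xx'.
Qed.

(** The preimage of a basic open set [U] minus [V] is the open set [h U] minus [h V]. *)
Lemma dual_map_continuous : continuous dual_map.
Proof.
move=> x W /=; rewrite nbhsE => -[W' [oW' W'x] W'W].
have [U [V [UP VP Ux Vx UVW]]] :=
  open_base (@esakia_compact Y) (clopen_upset_tb_closed Y) (fun _ => id)
    (@esakia_sep Y) oW' W'x.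
pose U' : clopup Y := exist _ U UP; pose V' : clopup Y := exist _ V VP.
have : nbhs x (sval (h U') `\` sval (h V')).
  apply: open_nbhs_nbhs; split.
    apply: openI; first by case: (svalP (h U')) => -[].
    by apply: closed_openC; case: (svalP (h V')) => -[].
  by split; [exact/(dual_mapP x U')|move/(dual_mapP x V')].
apply: filterS => z [zU zV]; apply: W'W; apply: UVW; split.
  exact/(dual_mapP z U').
by move/(dual_mapP z V').
Qed.

(** The back condition of Esakia morphisms. Compactness is applied to the closed sets of points
    above [x] in [h U] minus [h V], for [y] in [U] minus [V]. *)
Lemma dual_map_lift (x : X) (y : Y) :
  dual_map x <= y -> exists2 x', x <= x' & dual_map x' = y.
Proof.
have [h0 h1 hI hU hH] := hP.
move=> xy.
pose D := [set C : set X | exists U V : clopup Y,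
  [/\ sval U y, ~ sval V y &
      C = [set x' | x <= x'] `&` (sval (h U) `\` sval (h V))]].
have [x' Dx'] : exists x', forall C, D C -> C x'.
  apply: compact_directed; first exact: esakia_compact.
  - eexists; exists \top%O, \bot%O; split; last reflexivity; first by [].
    by [].
  - move=> _ _ [U [V [yU yV ->]]] [U' [V' [yU' yV' ->]]].
    exists ([set x' | x <= x'] `&` (sval (h (U `&` U')%O) `\` sval (h (V `|` V')%O))).
      by exists (U `&` U')%O, (V `|` V')%O; split=> // -[].
    rewrite hI hU => z [xz [[Uz Uz'] nV]].
    by split; split=> //; split=> // Vz; apply: nV; [left|right].
  - move=> _ [U [V [yU yV ->]]]; split.
      apply: closedI; first exact: closed_up (fun _ => id) (@esakia_sep X) x.
      by apply: closedI; [|apply: open_closedC];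
        case: (svalP (h U)) (svalP (h V)) => -[? ?] ? [[? ?] ?].
    apply: contrapT => UV0; apply: yV.
    (* Otherwise [x] lies in [h U -> h V = h (U -> V)], so [y] does in [U -> V]. *)
    have : sval (h (himp U V)) x.
      by rewrite hH clopup_himpE => -[x' UVx' xx']; apply: UV0; exists x'.
    move=> /(dual_mapP x (himp U V)) UVx.
    have UVy : upset_imp (sval U) (sval V) y by exact: upset_upset_imp UVx xy.
    by apply: contrapT => nVy; apply: UVy; exists y.
have Dx (U V : clopup Y) : sval U y -> ~ sval V y ->
    [/\ x <= x', sval (h U) x' & ~ sval (h V) x'].
  by move=> yU yV; have [? []] := Dx' _ (ex_intro _ U (ex_intro _ V (And3 yU yV erefl))).
exists x'; first by have [] := Dx \top%O \bot%O I (fun f => f).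
apply/le_anti/andP; split; apply: (sep_le (@esakia_sep Y)) => U UP.
- move=> /(dual_mapP x' (exist _ U UP)) xU; apply: contrapT => nUy.
  by have [_ _] := Dx \top%O (exist _ U UP) I nUy.
- move=> Uy; apply/(dual_mapP x' (exist _ U UP)).
  by have [] := Dx (exist _ U UP) \bot%O Uy (fun f => f).
Qed.

Lemma dual_map_morphism : esakia_morphism dual_map.
Proof.
split=> [|y]; first exact: dual_map_continuous.
apply/seteqP; split=> x.
  by move=> [x' /= <- xx']; exists (dual_map x') => //; exact: dual_map_le.
by move=> [_ /= -> /dual_map_lift[x' xx' <-]]; exists x'.
Qed.
End CUFull.

Lemma CU_full : full CU.
Proof.
move=> X Y h; exists (exist _ _ (dual_map_morphism (svalP h))).
apply: chom_eq; apply/funext => U; apply: sublattice_inj.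
by apply/seteqP; split=> x /= /(dual_mapP (svalP h) x U).
Qed.

(** * The prime spectrum of a Heyting algebra *)

Section PrimeFilters.
Variable A : heytingType disp.
Implicit Types (a b c x y : A) (P Q F : set A).

Record is_filter F : Prop := IsFilter {
  filter_top : F \top%O;
  filter_up : forall a b, F a -> a <= b -> F b;
  filter_meet : forall a b, F a -> F b -> F (a `&` b)%O }.

Record prime_filter P : Prop := PrimeFilter {
  prime_is_filter : is_filter P;
  prime_bot : ~ P \bot%O;
  prime_join : forall a b, P (a `|` b)%O -> P a \/ P b }.

(** For a filter [F], the filter generated by [F] and [a]. *)
Definition adjoin F a : set A := [set x | exists2 p, F p & (p `&` a <= x)%O].

Lemma adjoin_filter F a : is_filter F -> is_filter (adjoin F a).
Proof.
move=> [F1 Fup FI]; split.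
- by exists \top%O => //; exact: lex1.
- by move=> x y [p Fp px] xy; exists p => //; exact: le_trans xy.
- move=> x y [p Fp px] [q Fq qy]; exists (p `&` q)%O; first exact: FI.
  rewrite lexI (le_trans _ px) ?(le_trans _ qy) //.
    by rewrite leI2 ?leIr.
  by rewrite leI2 ?leIl.
Qed.

Lemma adjoin_sub F a : F `<=` adjoin F a.
Proof. by move=> p Fp; exists p => //; exact: leIl. Qed.

Lemma adjoin_mem F a : is_filter F -> adjoin F a a.
Proof. by move=> FF; exists \top%O; [exact: filter_top|exact: leIr]. Qed.

(** The prime filter theorem: a filter containing [F] and maximal among those avoiding [b] is
    prime. *)
Lemma prime_filter_extension F b : is_filter F -> ~ F b ->
  exists P, [/\ prime_filter P, F `<=` P & ~ P b].
Proof.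
move=> FF nFb.
(* Zorn's lemma asks for an upper bound of the empty chain too, hence the
   family of the [S] such that [F `|` S] is admissible. *)
pose good S := is_filter (F `|` S) /\ ~ (F `|` S) b.
have [C CP C_chain|S [[SF nSb] S_max]] := @Zorn_bigcup _ good.
  split; last by move=> [//|[S CS Sb]]; have [_] := CP S CS; apply; right.
  split; first by left; exact: filter_top FF.
  - move=> x y [Fx|[S CS Sx]] xy; first by left; exact: filter_up xy.
    have [SF _] := CP S CS.
    by have [|Sy] := filter_up SF (or_intror Sx) xy; [left|right; exists S].
  - have meet_one S x y : C S -> (F `|` S) x -> (F `|` S) y ->
        (F `|` \bigcup_(S in C) S) (x `&` y)%O.
      move=> CS Sx Sy; have [SF _] := CP S CS.
      by have [|Sxy] := filter_meet SF Sx Sy; [left|right; exists S].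
    move=> x y [Fx|[S CS Sx]] [Fy|[S' CS' Sy]].
    + by left; exact: (filter_meet FF).
    + by apply: meet_one CS' _ _; [left|right].
    + by apply: meet_one CS _ _; [right|left].
    + have [SS'|S'S] := C_chain S S' CS CS'.
        by apply: meet_one CS' _ _; right=> //; exact: SS'.
      by apply: meet_one CS _ _; right=> //; exact: S'S.
set P := F `|` S in SF nSb; have FP : F `<=` P by left.
(* By maximality, adjoining any element outside [P] forces [b] into the filter. *)
have adjoin_b a : ~ P a -> adjoin P a b.
  move=> nPa; apply: contrapT => nb.
  have aF := adjoin_filter a SF.
  have FaE : F `|` adjoin P a = adjoin P a.
    by apply/setUidPr; apply: subset_trans FP _; exact: adjoin_sub.
  apply: (S_max (adjoin P a)); last by rewrite /good FaE.
  split; last by move=> /(_ a (adjoin_mem a SF)) Sa; apply: nPa; right.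
  by apply: subset_trans (@adjoin_sub P a); right.
exists P; split=> //; split=> // [P0|x y Pxy].
  by apply: nSb; apply: (filter_up SF P0); exact: le0x.
have [Px|/adjoin_b[p Pp pxb]] := pselect (P x); first by left.
have [Py|/adjoin_b[q Pq qyb]] := pselect (P y); first by right.
exfalso; apply: nSb.
apply: (filter_up SF (filter_meet SF (filter_meet SF Pp Pq) Pxy)).
(* The adjunction with [himp] supplies distributivity, splitting the goal into one inequality for
   [x] and one for [y]. *)
rewrite meetC -le_himp leUx !le_himp; apply/andP; split.
  by apply: le_trans pxb; rewrite meetC leI2 ?leIl.
by apply: le_trans qyb; rewrite meetC leI2 ?leIr.
Qed.

(** * The spectrum as an ordered topological space *)

Definition spec := {P : set A | prime_filter P}.

HB.instance Definition _ := gen_eqMixin spec.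
HB.instance Definition _ := gen_choiceMixin spec.

Implicit Types p q : spec.

Let le p q := `[< sval p `<=` sval q >].
Let le_refl : reflexive le. Proof. by move=> p; apply/asboolP. Qed.
Let le_anti : antisymmetric le.
Proof.
move=> [P PP] [Q QQ] /andP[/asboolP /= PQ /asboolP /= QP].
have PQE : P = Q by apply/seteqP.
by subst Q; congr exist; exact: Prop_irrelevance.
Qed.
Let le_trans : transitive le.
Proof.
by move=> q p r /asboolP pq /asboolP qr; apply/asboolP; exact: subset_trans qr.
Qed.

HB.instance Definition _ :=
  Order.Le_isPOrder.Build disp spec le_refl le_anti le_trans.

Lemma spec_leP p q : reflect (sval p `<=` sval q) (p <= q)%O.
Proof. exact: asboolP. Qed.

Definition phi a : set spec := [set p | sval p a].

Lemma phi_bot : phi \bot%O = set0.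
Proof. by apply/seteqP; split=> // p; exact: (prime_bot (svalP p)). Qed.

Lemma phi_top : phi \top%O = setT.
Proof.
by apply/seteqP; split=> // p _; exact: filter_top (prime_is_filter (svalP p)).
Qed.

Lemma phi_meet a b : phi (a `&` b)%O = phi a `&` phi b.
Proof.
apply/seteqP; split=> p; have pF := prime_is_filter (svalP p).
  by move=> pab; split; apply: (filter_up pF pab); [exact: leIl|exact: leIr].
by move=> [pa pb]; exact: (filter_meet pF).
Qed.

Lemma phi_join a b : phi (a `|` b)%O = phi a `|` phi b.
Proof.
apply/seteqP; split=> p; first exact: (prime_join (svalP p)).
have pF := prime_is_filter (svalP p).
by move=> [pa|pb]; [apply: (filter_up pF pa)|apply: (filter_up pF pb)];
  [exact: leUl|exact: leUr].
Qed.

(** If [a] is not below [b], the principal filter of [a], obtained by adjoining [a] to the trivial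
    filter, extends to a prime filter avoiding [b]. *)
Lemma phi_le a b : phi a `<=` phi b <-> a <= b.
Proof.
split=> [ab|ab p pa]; last exact: (filter_up (prime_is_filter (svalP p)) pa ab).
apply: contrapT => /negP nab.
have T_filter : is_filter [set \top%O : A].
  split=> // [x y -> /= |x y -> -> /=]; last by rewrite meetxx.
  by rewrite le1x => /eqP.
have := adjoin_filter a T_filter.
move=> /(@prime_filter_extension _ b)[[_ -> /=]|P [PP aP nPb]].
  by rewrite meet1x; exact/negP.
by apply: nPb; apply: (ab (exist _ P PP)); apply: aP; exact: adjoin_mem.
Qed.

(** The topology generated by the sets [phi a] and their complements; the differences are closed
    under finite intersections, hence form a base. *)
Let op (U : set spec) : Prop := forall p, U p ->
  exists a b, [/\ phi a p, ~ phi b p & phi a `\` phi b `<=` U].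
Let opT : op setT.
Proof.
by move=> p _; exists \top%O, \bot%O; rewrite phi_top phi_bot; split.
Qed.
Let opI : setI_closed op.
Proof.
move=> U V oU oV p [/oU[a [b [pa pb abU]]] /oV[c [d [pc pd cdV]]]].
exists (a `&` c)%O, (b `|` d)%O; rewrite phi_meet phi_join; split=> //.
  by case.
by move=> q [[qa qc] nbd]; split; [apply: abU|apply: cdV]; split=> // ?;
  apply: nbd; [left|right].
Qed.
Let op_bigU (I : Type) (f : I -> set spec) :
  (forall i, op (f i)) -> op (\bigcup_i f i).
Proof.
move=> of_ p [i _ /of_[a [b [pa pb abf]]]]; exists a, b; split=> //.
by move=> q /abf; exists i.
Qed.

HB.instance Definition _ := isOpenTopological.Build spec opT opI op_bigU.

Lemma spec_openE (U : set spec) : open U = (forall p, U p ->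
  exists a b, [/\ phi a p, ~ phi b p & phi a `\` phi b `<=` U]).
Proof. by []. Qed.

Lemma open_phi a : open (phi a).
Proof.
by rewrite spec_openE => p pa; exists a, \bot%O; rewrite phi_bot setD0; split.
Qed.

Lemma closed_phi a : closed (phi a).
Proof.
rewrite -[phi a]setCK; apply: open_closedC; rewrite spec_openE => p npa.
by exists \top%O, a; rewrite phi_top setTD; split.
Qed.

Lemma upset_phi a : upset (phi a).
Proof. by move=> p q pa /spec_leP; apply. Qed.

Lemma phi_clopen_upset a : clopen_upset (phi a).
Proof. by split; [split; [exact: open_phi|exact: closed_phi]|exact: upset_phi]. Qed.

Lemma range_phi_tb_closed : tb_closed (range phi).
Proof.
split; [exists \bot%O|exists \top%O| |] => //; rewrite ?phi_bot ?phi_top //.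
  by move=> _ _ [a _ <-] [b _ <-]; exists (a `&` b)%O => //; rewrite phi_meet.
by move=> _ _ [a _ <-] [b _ <-]; exists (a `|` b)%O => //; rewrite phi_join.
Qed.

Lemma spec_sep p q : ~~ (p <= q)%O -> exists V, [/\ range phi V, V p & ~ V q].
Proof.
move=> /spec_leP /existsNP[a /not_implyP[pa nqa]].
by exists (phi a); split=> //; exists a.
Qed.

(* The elements [a] with [phi a] in an ultrafilter form its limit. *)
Lemma spec_compact : compact [set: spec].
Proof.
rewrite compact_ultra => F FU _.
have FF := @ultra_proper _ _ FU.
have PF : prime_filter [set a | F (phi a)].
  split; first split=> /=.
  - by rewrite phi_top; exact: filterT.
  - by move=> a b Fa /phi_le ab; apply: filterS Fa.
  - by move=> a b Fa Fb; rewrite phi_meet; exact: filterI.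
  - by rewrite /= phi_bot; exact: filter_not_empty.
  - move=> a b /= Fab; apply: contrapT => /not_orP[nFa nFb].
    have [//|Fa] := in_ultra_setVsetC (phi a) FU.
    have [//|Fb] := in_ultra_setVsetC (phi b) FU.
    have : F (phi (a `|` b)%O `&` (~` phi a `&` ~` phi b)).
      by apply: filterI => //; exact: filterI.
    by rewrite phi_join -setCU setICr => /filter_not_empty.
exists (exist _ _ PF); split=> // W; rewrite nbhsE => -[U [oU UP] UW].
move: oU; rewrite spec_openE => /(_ _ UP)[a [b [/= Fa nFb abU]]].
have Fb : F (~` phi b) by have [/nFb|] := in_ultra_setVsetC (phi b) FU.
apply: filterS (filterI Fa Fb) => q ab; exact: UW (abU q ab).
Qed.

(** If [p] misses [himp a b], the filter generated by [p] and [a] avoids [b], and a prime extension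
    of it is the required point above [p]. *)
Lemma down_phi a b : down (phi a `\` phi b) = ~` phi (himp a b).
Proof.
apply/seteqP; split=> [p [q [qa nqb] /spec_leP pq] pab|p pab].
  have qF := prime_is_filter (svalP q); apply: nqb.
  apply: (filter_up qF (filter_meet qF (pq _ pab) qa)).
  by rewrite -le_himp.
have pF := prime_is_filter (svalP p).
have [[r pr rab]|Q [QP pQ nQb]] :=
    prime_filter_extension (adjoin_filter a pF) (b := b).
  by apply: pab; apply: (filter_up pF pr); rewrite le_himp.
exists (exist _ Q QP); first by split=> //; apply: pQ; exact: adjoin_mem.
by apply/spec_leP; apply: subset_trans pQ; exact: adjoin_sub.
Qed.

Let range_phi_clopen V : range phi V -> clopen V /\ upset V.
Proof. by move=> [a _ <-]; exact: phi_clopen_upset. Qed.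

(** The downset of a clopen set is closed by compactness. It is open because the downset of a basic
    open set is, by [down_phi], the complement of some [phi c]. *)
Lemma spec_esakia : esakia_space spec.
Proof.
split; first exact: spec_compact.
  move=> p q /spec_sep[V [rV Vp Vq]]; exists V.
  by have [? ?] := range_phi_clopen rV.
move=> U [oU cU]; split; last first.
  exact: (closed_down spec_compact range_phi_tb_closed range_phi_clopen
    spec_sep cU).
rewrite spec_openE => p [q Uq pq].
have [a [b [qa nqb abU]]] := oU q Uq.
exists \top%O, (himp a b); rewrite phi_top setTD -down_phi; split=> //.
  have : down (phi a `\` phi b) p by exists q.
  by rewrite down_phi.
by move=> r [s /abU Us rs]; exists s.
Qed.

Definition Spec : esakia := Esakia spec_esakia.

Lemma clopen_upset_phi (U : set spec) : clopen_upset U -> exists a, phi a = U.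
Proof.
move=> [cU uU].
have [a _ <-] := clopen_upset_base spec_compact range_phi_tb_closed
  range_phi_clopen spec_sep cU uU.
by exists a.
Qed.
End PrimeFilters.

(** * Heyting algebras as clopen upsets of their spectra *)

Section SpecClopup.
Variable A : heytingType disp.

Definition phi_clopup (a : A) : clopup (Spec A) :=
  exist _ (phi a) (phi_clopen_upset a).

Lemma phi_clopup_le a b : (phi_clopup a <= phi_clopup b)%O = (a <= b)%O.
Proof. by apply/clopup_leP/idP => /phi_le. Qed.

Lemma phi_clopup_surj U : exists a, phi_clopup a = U.
Proof.
have [a aU] := clopen_upset_phi (svalP U).
by exists a; exact: sublattice_inj.
Qed.
End SpecClopup.

Lemma CU_essentially_surjective : essentially_surjective CU.
Proof.
move=> A; have phiP :=
  heyting_morphism_of_order_iso (@phi_clopup_le A) (@phi_clopup_surj A).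
have [g [gphi phig]] := @isomorphism_of_order_iso A (clopup (Spec A))
  (exist _ _ phiP) (@phi_clopup_le A) (@phi_clopup_surj A).
(* Arrows are reversed in the opposite category, so [phi_clopup] is the arrow towards [A] and the
   two inverse laws trade places. *)
exists (Spec A), (exist _ _ phiP); exists g; split.
  exact: phig.
exact: gphi.
Qed.

(** * The frame of open upsets of an Esakia space *)

Definition open_upset (X : esakia) : set (set X) := [set U | open U /\ upset U].

Lemma open_upset_tb_closed (X : esakia) : tb_closed (@open_upset X).
Proof.
split=> [||U V [oU uU] [oV uV]|U V [oU uU] [oV uV]].
- split; [exact: open0|exact: upset0].
- split; [exact: openT|exact: upsetT].
- split; [exact: openI|exact: upsetI].
- split; [exact: openU|exact: upsetU].
Qed.

Definition opup (X : esakia) := sublattice (open_upset_tb_closed X).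

Section Opup.
Variable X : esakia.
Implicit Types (U V W : opup X) (A : set (opup X)).

HB.instance Definition _ := Order.TBLattice.on (opup X).

Lemma opup_leP U V : reflect (sval U `<=` sval V) (U <= V)%O.
Proof. exact: subsetPset. Qed.

Lemma opup_bigcup A : open_upset (\bigcup_(U in A) sval U).
Proof.
split; first by apply: bigcup_open => U _; case: (svalP U).
by apply: upset_bigcup => U _; case: (svalP U).
Qed.

Let fsup A : opup X := exist _ _ (opup_bigcup A).

Let fsup_supremums A : supremums A (fsup A).
Proof.
split=> [U AU|V AV]; apply/opup_leP; first by move=> x Ux; exists U.
by move=> x [U AU Ux]; have /opup_leP := AV U AU; apply.
Qed.

Let meet_fsup U A : (U `&` fsup A)%O = fsup [set (U `&` V)%O | V in A].
Proof.
apply: sublattice_inj; apply/seteqP; split=> x.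
  by move=> [Ux [V AV Vx]]; exists (U `&` V)%O => //; exists V.
by move=> [_ [V AV <-] [Ux Vx]]; split=> //; exists V.
Qed.

HB.instance Definition _ :=
  TBLattice_isFrame.Build disp (opup X) fsup_supremums meet_fsup.

(** If no finite part of [A] covers [U], the closed remainders are directed and nonempty, so some
    point of [U] escapes every member of [A]. *)
Lemma clopen_compact_element U : clopen (sval U) -> compact_element U.
Proof.
move=> [_ cU] A /opup_leP UA; apply: contrapT => noF.
pose D := [set C | exists F : set (opup X), [/\ finite_set F, F `<=` A &
  C = sval U `\` \bigcup_(V in F) sval V]].
have [x Dx] : exists x, forall C, D C -> C x.
  apply: compact_directed; first exact: esakia_compact.
  - by eexists; exists set0; split; [exact: finite_set0|exact: sub0set|].
  - move=> _ _ [F [finF FA ->]] [G [finG GA ->]].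
    exists (sval U `\` \bigcup_(V in F `|` G) sval V).
      exists (F `|` G); split=> //; first by rewrite finite_setU.
      by move=> V [/FA|/GA].
    by move=> x [Ux nFG]; split; split=> // -[V ? ?]; apply: nFG; exists V => //;
      [left|right].
  - move=> _ [F [finF FA ->]]; split.
      by apply: closedI => //; apply: open_closedC; have [] := opup_bigcup F.
    apply/set0P/eqP; rewrite setD_eq0 => UF; apply: noF.
    by exists F; split=> //; apply/opup_leP.
have [Ux _] : (sval U `\` \bigcup_(V in (set0 : set (opup X))) sval V) x.
  by apply: Dx; exists set0; split; [exact: finite_set0|exact: sub0set|].
have [V AV Vx] := UA x Ux.
have : (sval U `\` \bigcup_(V in [set V]) sval V) x.
  by apply: Dx; exists [set V]; split; [exact: finite_set1|move=> _ ->|].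
by move=> [_]; apply; exists V.
Qed.

Lemma opup_clopen_sup U :
  U = Defs.fsup [set V : opup X | clopen (sval V) /\ (V <= U)%O].
Proof.
apply/le_anti/andP; split; last by apply: fsup_le => V [].
apply/opup_leP => x Ux; have [oU uU] := svalP U.
have [V [[cV uV] Vx VU]] := open_upset_base (@esakia_compact X)
  (clopen_upset_tb_closed X) (fun _ => id) (@esakia_sep X) oU uU Ux.
have oV : open V by case: cV.
exists (exist _ V (conj oV uV)) => //; split=> //.
exact/opup_leP.
Qed.

(** [U] is the union of the clopen upsets inside it, hence by compactness a finite union of them. *)
Lemma compact_element_clopen U : compact_element U -> clopen (sval U).
Proof.
move=> /(_ [set V : opup X | clopen (sval V) /\ (V <= U)%O]).
rewrite -opup_clopen_sup lexx => /(_ isT)[F [finF FU UF]].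
have -> : U = Defs.fsup F.
  by apply/le_anti; rewrite UF; apply: fsup_le => V /FU[].
apply: (@finite_fsup_closed _ F (fun V : opup X => clopen (sval V))) => //.
- exact: clopen0.
- by move=> V W; exact: clopenU.
- by move=> V /FU[].
Qed.

Lemma opup_coherent : coherent_frame (opup X).
Proof.
split.
- by apply: clopen_compact_element; exact: clopenT.
- move=> U V /compact_element_clopen cU /compact_element_clopen cV.
  by apply: clopen_compact_element; exact: clopenI.
- move=> U; rewrite [LHS]opup_clopen_sup; congr Defs.fsup.
  apply/seteqP; split=> V [KV VU]; split=> //.
    exact: clopen_compact_element.
  exact: compact_element_clopen.
Qed.

(** For clopen arguments [upset_imp] is open, so it satisfies the adjunction that characterizes the
    implication of the frame. *)
Lemma opup_frame_impE U V : clopen (sval U) -> clopen (sval V) ->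
  sval (frame_imp U V) = upset_imp (sval U) (sval V).
Proof.
move=> cU cV; have [[oUV _] uUV] := clopen_upset_imp cU cV.
suff -> : frame_imp U V = exist _ _ (conj oUV uUV) :> opup X by [].
apply/le_anti/andP; split.
  apply/opup_leP; apply/(upset_impP _ _ (proj2 (svalP (frame_imp U V)))).
  have := le_frame_imp (frame_imp U V) U V.
  by rewrite lexx => /esym /opup_leP.
by rewrite le_frame_imp; apply/opup_leP; apply/upset_impP.
Qed.

Lemma opup_heyting : heyting_subalgebra (@compact_element (opup X)).
Proof.
split.
- by apply: clopen_compact_element; exact: clopen0.
- by apply: clopen_compact_element; exact: clopenT.
- move=> U V /compact_element_clopen cU /compact_element_clopen cV.
  by apply: clopen_compact_element; exact: clopenI.
- move=> U V /compact_element_clopen cU /compact_element_clopen cV.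
  by apply: clopen_compact_element; exact: clopenU.
- move=> U V /compact_element_clopen cU /compact_element_clopen cV.
  apply: clopen_compact_element; rewrite opup_frame_impE //.
  by have [] := clopen_upset_imp cU cV.
Qed.

Definition OpUp : heytFrame := HeytFrame opup_coherent opup_heyting.
End Opup.

(** * Heyting algebras as compact open upsets of their spectra *)

Section SpecCompacts.
Variable A : heytingType disp.

Lemma phi_open_upset (a : A) : open_upset (phi a : set (Spec A)).
Proof. by split; [exact: open_phi|exact: upset_phi]. Qed.

Definition phi_opup (a : A) : opup (Spec A) := exist _ (phi a) (phi_open_upset a).

Lemma phi_compact (a : A) : compact_element (phi_opup a).
Proof. by apply: clopen_compact_element; have [] := phi_clopen_upset a. Qed.

Definition phi_compacts (a : A) : compacts (OpUp (Spec A)) :=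
  exist _ (phi_opup a) (@phi_compact a).

Lemma phi_compacts_le a b : (phi_compacts a <= phi_compacts b)%O = (a <= b)%O.
Proof. by rewrite compacts_leE; apply/opup_leP/idP => /phi_le. Qed.

Lemma phi_compacts_surj U : exists a, phi_compacts a = U.
Proof.
have cU := compact_element_clopen (svalP U).
have [a aU] := clopen_upset_phi (conj cU (proj2 (svalP (sval U)))).
by exists a; apply: sublattice_inj; exact: sublattice_inj.
Qed.
End SpecCompacts.

Lemma K_essentially_surjective : essentially_surjective K.
Proof.
move=> A; have phiP :=
  heyting_morphism_of_order_iso (@phi_compacts_le A) (@phi_compacts_surj A).
have [g [gphi phig]] := @isomorphism_of_order_iso A (compacts (OpUp (Spec A)))
  (exist _ _ phiP) (@phi_compacts_le A) (@phi_compacts_surj A).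
by exists (OpUp (Spec A)), g, (exist _ _ phiP).
Qed.

Theorem theorem3p14 :
  equivalent HeytFrm HA /\ dually_equivalent HeytFrm ES.
Proof.
split.
  exact: (equivalent_of_fully_faithful K_full K_faithful
    K_essentially_surjective).
(* The opposite of [HA] links the two sides: [K] is used with reversed arrows, and [CU] takes values
   there. *)
apply: (@equivalent_trans _ (opposite HA)).
  exact: (opposite_equivalent_of_fully_faithful K_full K_faithful
    K_essentially_surjective).
apply: equivalent_sym.
exact: (equivalent_of_fully_faithful CU_full CU_faithful
  CU_essentially_surjective).
Qed.
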